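(* Suppose that $m_3 = \tfrac45$, i.e. that for every cubic bridgeless graph $G$ one has $m_3(G)\ge \tfrac45$ and the infimum of $m_3(G)$ over all cubic bridgeless graphs equals $\tfrac45$. Then every cubic bridgeless graph $G$ has three perfect matchings $M_1,M_2,M_3$ such that $M_1\cap M_2\cap M_3=\emptyset$ and $|M_1\cup M_2\cup M_3|\ge \tfrac45\,|E(G)|$. In particular, under this assumption every cubic bridgeless graph has three perfect matchings with empty common intersection.
   Context: A cubic bridgeless graph is a graph in which every vertex has degree 3 and each connected component is 2-edge-connected. A perfect matching of $G$ is a set of edges such that every vertex is incident to exactly one of them. For a cubic bridgeless graph $G$ and a positive integer $t$, $m_t(G)$ denotes the maximum, over all choices of $t$ perfect matchings $M_1,\dots,M_t$ of $G$, of $|M_1\cup\dots\cup M_t|/|E(G)|$, and $m_t$ denotes the infimum of $m_t(G)$ over all cubic bridgeless graphs $G$. *)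

(* Defs.v *)
From HB Require Import structures.
From mathcomp Require Import all_boot all_order all_algebra.
From mathcomp Require Import classical_sets reals.

Set Implicit Arguments.
Unset Strict Implicit.
Unset Printing Implicit Defensive.

Import Order.TTheory GRing.Theory Num.Theory.
Local Open Scope ring_scope.

(* Finite graphs with parallel edges allowed.  Loops are left out: in a cubic
   graph a loop (counted twice in the degree) forces the third edge at its
   vertex to be a bridge, so a bridgeless cubic graph has none. *)
Record graph := Graph {
  vertex : finType;
  edge : finType;
  ends : edge -> {set vertex};
  card_ends : forall e, #|ends e| = 2%N
}.

Section GraphDefs.
Variable G : graph.

Definition edges_at (v : vertex G) : {set edge G} := [set e | v \in ends e].

Definition cubic : Prop := forall v : vertex G, #|edges_at v| = 3%N.

Definition adj : rel (vertex G) :=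
  fun x y => [exists e, ends e == [set x; y]].

Definition component (x : vertex G) : {set vertex G} :=
  [set y | connect adj x y].

(* Adjacency in G[A] - F, the subgraph induced by A with the edges of F
   deleted. *)
Definition adj_in (A : {set vertex G}) (F : {set edge G}) : rel (vertex G) :=
  fun x y =>
    [&& x \in A, y \in A & [exists e, (e \notin F) && (ends e == [set x; y])]].

Definition edge_connected (k : nat) (A : {set vertex G}) : Prop :=
  (1 < #|A|)%N /\
  forall F : {set edge G}, (#|F| < k)%N ->
  forall x y, x \in A -> y \in A -> connect (adj_in A F) x y.

(* The null graph is excluded: |E| is a denominator below. *)
Definition cubic_bridgeless : Prop :=
  [/\ (0 < #|vertex G|)%N, cubic &
      forall x : vertex G, edge_connected 2 (component x)].

Definition perfect_matching (M : {set edge G}) : bool :=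
  [forall v, #|M :&: edges_at v| == 1%N].

(* By Petersen's theorem a bridgeless cubic graph has a perfect matching, so
   the default value 0 of the maximum plays no role for such graphs. *)
Definition max_cover (R : realType) (t : nat) : R :=
  \big[Num.max/0]_(M : {ffun 'I_t -> {set edge G}} |
                   [forall i, perfect_matching (M i)])
    (#|(\bigcup_(i < t) M i)%SET|%:R / #|edge G|%:R).

End GraphDefs.

Definition inf_max_cover (R : realType) (t : nat) : R :=
  inf [set x : R | exists G : graph,
                     cubic_bridgeless G /\ x = max_cover G R t]%classic.

(* Main.v *)
(* Replace every edge of G by a copy of the Petersen graph with one edge cut
   open, giving a cubic bridgeless graph G' with 16|E| edges.  Perfect matchings
   of G' restrict to perfect matchings of G, and to perfect matchings of the
   Petersen graph in each copy.  Three of the latter cover at most 12 of the 15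
   edges, and at most 9 if all of them use the cut edge.  With U, I the union and
   intersection of three matchings of G, and U', I' those for G', this gives
   |U'| + 3|I| <= 12|E| + |U| and 2|I| <= |I'|, so an inequality
   4/5 |E'| + k|I'| <= |U'| for G' descends to 4/5 |E| + (2k + 3)|I| <= |U|.
   Iterating the substitution makes k exceed |E|, which forces I to be empty. *)
Require Import Defs.
From mathcomp Require Import all_boot all_order all_algebra.
From mathcomp Require Import classical_sets reals.
From mathcomp Require Import zify.

Set Implicit Arguments.
Unset Strict Implicit.
Unset Printing Implicit Defensive.

Import Order.TTheory GRing.Theory Num.Theory.
Local Open Scope ring_scope.

(** * Bridgelessness, edge by edge *)

Section Bridgeless.
Local Open Scope nat_scope.
Local Open Scope set_scope.
Variable G : graph.
Implicit Types (x y : vertex G) (e f : edge G) (A : {set vertex G}).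

Definition adj_avoid f : rel (vertex G) :=
  fun x y => [exists e, (e != f) && (ends e == [set x; y])].

Lemma adj_avoid_sym f : symmetric (adj_avoid f).
Proof. by move=> x y; apply: eq_existsb => e; rewrite finset.setUC. Qed.

Lemma connect_avoid_sym f : connect_sym (adj_avoid f).
Proof. exact/sym_connect_sym/adj_avoid_sym. Qed.

Lemma ends_adj e x y : ends e = [set x; y] -> adj x y.
Proof. by move=> ee; apply/existsP; exists e; rewrite ee. Qed.

Lemma adj_avoid_adj f : subrel (adj_avoid f) (@adj G).
Proof. by move=> x y /existsP[e /andP[_ /eqP/ends_adj]]. Qed.

Lemma connect_within (T : finType) (r r' : rel T) (A : {pred T}) :
  (forall x y : T, x \in A -> r x y -> y \in A /\ connect r' x y) ->
  forall x y : T, x \in A -> connect r x y -> connect r' x y.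
Proof.
move=> rr' x y xA /connectP[p pp ->].
elim: p x xA pp => //= z p IHp x xA /andP[/(rr' _ _ xA)[zA xz] pp].
exact/(connect_trans xz)/IHp.
Qed.

Lemma component_adj z x y :
  x \in component z -> adj x y -> y \in component z.
Proof. by rewrite !inE => zx xy; apply/(connect_trans zx)/connect1. Qed.

Lemma bridgeless_connect_avoid f x y :
  edge_connected 2 (component x) -> ends f = [set x; y] ->
  connect (adj_avoid f) x y.
Proof.
move=> [_ /(_ [set f])]; rewrite cards1 => /(_ isT x y) cxy fxy.
apply: connect_sub (cxy _ _) => [u v /and3P[_ _ /existsP[e]]||].
- by rewrite !inE => euv; apply/connect1/existsP; exists e.
- by rewrite inE connect0.
- by rewrite inE connect1 // (ends_adj fxy).
Qed.

(** Fewer than two deleted edges means at most one, so in a walk of [G] every use of the deleted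
    edge can be replaced by the detour that avoids it. *)
Lemma connect_avoid_bridgeless :
  cubic G ->
  (forall f x y, ends f = [set x; y] -> connect (adj_avoid f) x y) ->
  forall x, edge_connected 2 (component x).
Proof.
move=> cubG nobridge z; split=> [|F F2].
  have /card_gt0P[e] : 0 < #|edges_at z| by rewrite cubG.
  rewrite inE -(card_ends e) => ze.
  apply/subset_leq_card/fintype.subsetP => y ye.
  have [->|yz] := eqVneq y z; first by rewrite inE connect0.
  rewrite inE connect1 // (@ends_adj e) //; apply/esym/eqP.
  rewrite eqEcard finset.subUset !finset.sub1set ze ye.
  by rewrite card_ends cards2 eq_sym yz.
move=> x y xz yz.
have adj_sym : symmetric (@adj G).
  by move=> u v; apply: eq_existsb => e; rewrite finset.setUC.
have: connect (@adj G) x y.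
  move: xz yz; rewrite !inE => zx; apply: connect_trans.
  by rewrite (sym_connect_sym adj_sym).
apply: (connect_within _ xz) => u v uz uv.
split; first exact: component_adj uv.
have /existsP[g /eqP guv] := uv.
have [gF|gF] := boolP (g \in F); last first.
  apply/connect1; rewrite /adj_in uz (component_adj uz uv).
  by apply/existsP; exists g; rewrite gF guv eqxx.
apply: (connect_within _ uz (nobridge _ _ _ guv)) => a b az ab.
have bz := component_adj az (adj_avoid_adj ab); split=> //.
apply/connect1; rewrite /adj_in az bz; have /existsP[e /andP[eg eab]] := ab.
apply/existsP; exists e; rewrite eab andbT; apply: contra eg => eF.
by apply/eqP; apply: (card_le1_eqP (A := mem F)) => //.
Qed.

End Bridgeless.

(** * An arbitrary orientation, to tell the two ends of an edge apart *)

Section Orientation.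
Local Open Scope nat_scope.
Local Open Scope set_scope.
Variable G : graph.

Lemma ends_pair (e : edge G) :
  exists p : vertex G * vertex G, (p.1 != p.2) && (ends e == [set p.1; p.2]).
Proof.
have /eqP/cards2P[x [y [xy ->]]] := card_ends e.
by exists (x, y); rewrite /= xy eqxx.
Qed.

Definition src (e : edge G) := (xchoose (ends_pair e)).1.
Definition tgt (e : edge G) := (xchoose (ends_pair e)).2.

Lemma src_neq_tgt e : src e != tgt e.
Proof. by case/andP: (xchooseP (ends_pair e)). Qed.

Lemma ends_src_tgt e : ends e = [set src e; tgt e].
Proof. by case/andP: (xchooseP (ends_pair e)) => _ /eqP. Qed.

End Orientation.

(** * The Petersen gadget *)

Section Gadget.
Local Open Scope nat_scope.

(* The Petersen graph has outer cycle 0..4, spokes joining i to i+5, and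
   inner edges joining i+5 to (i+2 mod 5)+5.  Its edge joining 0 and 1 is cut
   into the half-edges numbered 0 (at vertex 0) and 15 (at vertex 1); the value
   10 stands for the missing end of a half-edge. *)
Definition gadget_end1 : seq nat :=
  [:: 0; 1; 2; 3; 4; 0; 1; 2; 3; 4; 5; 7; 9; 6; 8; 1].
Definition gadget_end2 : seq nat :=
  [:: 10; 2; 3; 4; 0; 5; 6; 7; 8; 9; 7; 9; 6; 8; 5; 10].

Definition gadget_inc (p i : nat) : bool :=
  (p == nth 10 gadget_end1 i) || (p == nth 10 gadget_end2 i).

(** These are the six perfect matchings of the Petersen graph; the cut edge appears as the pair 0,
    15. *)
Definition gadget_matchings : seq (seq nat) :=
  [:: [:: 5; 6; 7; 8; 9]; [:: 1; 3; 5; 11; 13]; [:: 2; 4; 6; 11; 14];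
      [:: 0; 3; 7; 12; 14; 15]; [:: 1; 4; 8; 10; 12]; [:: 0; 2; 9; 10; 13; 15]].

Lemma gadget_cubic p : p < 10 -> count (gadget_inc p) (iota 0 16) = 3.
Proof. by do 10! [case: p => [|p] //]. Qed.

(** Agreement of [b 0] and [b 15] is not assumed: the full edges cover an even number of the ten
    vertices, so parity forces it. *)
Lemma gadget_perfect_matching (b : nat -> bool) :
  (forall p, p < 10 ->
     count (fun i => gadget_inc p i && b i) (iota 0 16) = 1) ->
  exists2 t, t \in gadget_matchings & {in iota 0 16, b =1 mem t}.
Proof.
move=> pm.
have [t tP bt] : exists2 t, t \in gadget_matchings &
    map b (iota 0 16) = map (mem t) (iota 0 16).
  move: (pm 0 isT) (pm 1 isT) (pm 2 isT) (pm 3 isT) (pm 4 isT) (pm 5 isT).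
  move: (pm 6 isT) (pm 7 isT) (pm 8 isT) (pm 9 isT) => {pm} /=.
  rewrite /gadget_inc /= !add0n.
  (* The edges are taken vertex by vertex, starting around the outer cycle, so that a violated
     vertex condition closes its branch early. *)
  case: (b 0); case: (b 4) => //=; case: (b 5) => //=;
  case: (b 15); case: (b 1) => //=; case: (b 6) => //=;
  case: (b 2) => //=; case: (b 7) => //=; case: (b 3) => //=;
  case: (b 8) => //=; case: (b 9) => //=; case: (b 10) => //=;
  case: (b 14) => //=; case: (b 11) => //=; case: (b 12) => //=;
  case: (b 13) => //= *;
  by [ exists [:: 5; 6; 7; 8; 9] | exists [:: 1; 3; 5; 11; 13]
     | exists [:: 2; 4; 6; 11; 14] | exists [:: 0; 3; 7; 12; 14; 15]
     | exists [:: 1; 4; 8; 10; 12] | exists [:: 0; 2; 9; 10; 13; 15]].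
exists t => // i i16; have i16' : i < size (iota 0 16).
  by rewrite size_iota; rewrite mem_iota in i16.
have := congr1 (nth false ^~ i) bt; rewrite !(nth_map 0) // nth_iota //.
Qed.

(* An edge of the Petersen graph lies in only two of its six perfect
   matchings, so three matchings sharing the cut edge are not distinct and
   cover at most nine edges. *)
Lemma gadget_cover t1 t2 t3 :
  t1 \in gadget_matchings -> t2 \in gadget_matchings ->
  t3 \in gadget_matchings ->
  count (fun i => [|| i \in t1, i \in t2 | i \in t3]) (iota 0 16) +
    3 * [&& 0 \in t1, 0 \in t2 & 0 \in t3]
  <= 12 + [|| 0 \in t1, 0 \in t2 | 0 \in t3].
Proof.
have /allP H : all (fun t1 => all (fun t2 => all (fun t3 =>
   count (fun i => [|| i \in t1, i \in t2 | i \in t3]) (iota 0 16) +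
    3 * [&& 0 \in t1, 0 \in t2 & 0 \in t3]
  <= 12 + [|| 0 \in t1, 0 \in t2 | 0 \in t3])
    gadget_matchings) gadget_matchings) gadget_matchings by vm_compute.
by move=> /H/allP H1 /H1/allP H2 /H2.
Qed.

(** One round of breadth-first search along the full edges 1 to 14 other than [j]; half-edges are
    never followed. *)
Definition gadget_step (j : nat) (s : seq nat) : seq nat :=
  s ++ flatten [seq (if nth 10 gadget_end1 i \in s
                     then [:: nth 10 gadget_end2 i] else [::]) ++
                    (if nth 10 gadget_end2 i \in s
                     then [:: nth 10 gadget_end1 i] else [::])
               | i <- iota 1 14 & i != j].

(** The Petersen graph is 3-edge-connected, so it stays connected without the cut edge and edge
    [j]. *)
Lemma gadget_reach j p :
  j < 16 -> p < 10 -> p \in iter 5 (gadget_step j) [:: 0].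
Proof.
have /allP H : all (fun j => all (fun p => p \in iter 5 (gadget_step j) [:: 0])
    (iota 0 10)) (iota 0 16) by vm_compute.
by move=> j16 p10; apply: (allP (H j _)); rewrite mem_iota.
Qed.

End Gadget.

(** * Substituting the gadget for every edge *)

Section Substitution.
Local Open Scope nat_scope.
Local Open Scope set_scope.
Variable G : graph.

Definition sub_vertex : finType := (vertex G + edge G * 'I_10)%type.
Definition sub_edge : finType := (edge G * 'I_16)%type.

(** The missing end 10 of a half-edge becomes an end of the replaced edge: half-edge 0 is attached
    to its source, half-edge 15 to its target. *)
Definition sub_end1 (d : sub_edge) : sub_vertex :=
  if d.2 == 0 :> nat then inl (src d.1)
  else if d.2 == 15 :> nat then inl (tgt d.1)
  else inr (d.1, inord (nth 10 gadget_end2 d.2)).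

Definition sub_end2 (d : sub_edge) : sub_vertex :=
  inr (d.1, inord (nth 10 gadget_end1 d.2)).

Definition sub_ends (d : sub_edge) : {set sub_vertex} :=
  [set sub_end1 d; sub_end2 d].

Lemma card_sub_ends d : #|sub_ends d| = 2.
Proof.
rewrite cards2; case: d => e [i i16]; rewrite /sub_end1 /sub_end2 /=.
by do 16 ?[case: i i16 => [|i] i16 //=];
  rewrite (inj_eq inr_inj) xpair_eqE -val_eqE /= !inordK // andbF.
Qed.

Definition substitute : graph := Graph card_sub_ends.

Lemma inr_sub_ends e p d :
  (inr (e, p) \in sub_ends d) = (e == d.1) && gadget_inc p d.2.
Proof.
case: d => e' [i i16]; rewrite !inE /gadget_inc /sub_end1 /sub_end2 /=.
by do 16 ?[case: i i16 => [|i] i16 //=];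
  rewrite ?(inj_eq inr_inj) ?xpair_eqE -?val_eqE /= ?inordK //;
  case: (e == e'); rewrite //= ?orbF; case: p => [[|p] ?] //=; lia.
Qed.

(** This is the half-edge attached to [v] only when [v] is an end of [e]; otherwise it defaults to
    [ord_max]. *)
Definition half_edge (v : vertex G) (e : edge G) : sub_edge :=
  (e, if v == src e then ord0 else ord_max).

Lemma inl_sub_ends v d :
  (inl v \in sub_ends d) = (v \in ends d.1) && (d == half_edge v d.1).
Proof.
case: d => e [i i16]; rewrite !inE /sub_end1 /sub_end2 /= ends_src_tgt !inE.
rewrite xpair_eqE eqxx /= orbF -val_eqE /=.
have /negPf st := src_neq_tgt e.
have [->|vs] /= := eqVneq v (src e); have [i0|i0] := eqVneq i 0.
- by rewrite eqxx.
- by case: (eqVneq i 15).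
- by rewrite i0 andbF; exact: negbTE.
- by case: (eqVneq i 15) => _; rewrite ?andbT ?andbF.
Qed.

Lemma edges_at_inl v :
  @edges_at substitute (inl v) = half_edge v @: edges_at v.
Proof.
apply/finset.setP => d; rewrite inE inl_sub_ends; apply/andP/imsetP.
  by case=> vd /eqP ->; exists d.1; rewrite ?inE.
by case=> e; rewrite inE => ve ->; rewrite ve eqxx.
Qed.

Lemma half_edge_inj v : injective (half_edge v).
Proof. by move=> e e' []. Qed.

Lemma card_ord_count n (P : pred nat) :
  #|[set i : 'I_n | P i]| = count P (iota 0 n).
Proof.
by rewrite cardsE cardE size_filter -enumT -val_enum_ord count_map.
Qed.

Lemma card_pair_slice (T U : finType) (x : T) (P : pred U) :
  #|[set d : T * U | (x == d.1) && P d.2]| = #|[set i | P i]|.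
Proof.
rewrite -[RHS](card_imset _ (f := pair x)); last by move=> i j [].
apply: eq_card => -[y i]; rewrite inE /=; apply/andP/imsetP => /=.
  by case=> /eqP <- Pi; exists i; rewrite ?inE.
by case=> j; rewrite inE => Pj [-> ->].
Qed.

Lemma card_pair_sum (T U : finType) (A : {set T * U}) :
  #|A| = \sum_x #|[set i | (x, i) \in A]|.
Proof.
rewrite -sum1_card (partition_big fst xpredT) //=; apply: eq_bigr => x _.
rewrite sum1dep_card -[RHS](card_imset _ (f := pair x)); last by move=> i j [].
apply: eq_card => -[y i]; rewrite inE /=; apply/andP/imsetP => /=.
  by case=> Ayi /eqP <-; exists i; rewrite ?inE.
by case=> j; rewrite inE => Aj [-> ->].
Qed.

Lemma edges_at_inr e p :
  @edges_at substitute (inr (e, p)) =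
  [set d : sub_edge | (e == d.1) && gadget_inc p d.2].
Proof.
by apply/finset.setP => d; rewrite [LHS]inE [RHS]inE; apply: inr_sub_ends.
Qed.

Lemma substitute_cubic : cubic G -> cubic substitute.
Proof.
move=> cubG [v|[e p]].
  by rewrite edges_at_inl card_imset ?cubG //; apply: half_edge_inj.
rewrite edges_at_inr (card_pair_slice e (fun i : 'I_16 => gadget_inc p i)).
by rewrite card_ord_count gadget_cubic.
Qed.

(** The search avoids the edge numbered [f.2] even when [f] lies in another copy, which saves a case
    distinction. *)
Lemma gadget_connect (f : edge substitute) e p q :
  connect (@adj_avoid substitute f) (inr (e, p)) (inr (e, q)).
Proof.
suff from0 r : connect (@adj_avoid substitute f) (inr (e, ord0)) (inr (e, r)).
  by apply: connect_trans (from0 q); rewrite connect_avoid_sym.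
pose R (k : nat) := connect (@adj_avoid substitute f)
  (inr (e, ord0)) (inr (e, inord k : 'I_10)).
suff: R r by rewrite /R inord_val.
suff Riter n s : {in s, forall k, R k} ->
    {in iter n (gadget_step f.2) s, forall k, R k}.
  apply: (Riter 5 [:: 0]); last exact: gadget_reach.
  move=> k; rewrite inE => /eqP ->; rewrite /R.
  rewrite (_ : inord 0 = ord0) ?connect0 //.
  by apply/val_inj; rewrite /= inordK.
elim: n s => [|n IHn] s sR //; rewrite iterSr; apply: IHn => k.
rewrite mem_cat => /orP[/sR //|].
case/flatten_mapP => i; rewrite mem_filter mem_iota => /andP[ij i15].
have step : @adj_avoid substitute f
    (inr (e, inord (nth 10 gadget_end1 i)))
    (inr (e, inord (nth 10 gadget_end2 i))).
  apply/existsP; exists (e, inord i : 'I_16); apply/andP; split.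
    by apply: contra ij => /eqP <- /=; rewrite inordK //; lia.
  rewrite finset.setUC /= /sub_ends /sub_end1 /sub_end2 /= inordK; last by lia.
  by rewrite !ifN //; lia.
rewrite mem_cat; case/orP; case: ifP => // /sR Ri; rewrite inE => /eqP ->.
  exact: connect_trans Ri (connect1 step).
by apply: connect_trans Ri (connect1 _); rewrite adj_avoid_sym.
Qed.

Lemma sub_edge_connect (f d : edge substitute) p :
  d != f -> connect (@adj_avoid substitute f) (sub_end1 d) (inr (d.1, p)).
Proof.
move=> df; apply: connect_trans (connect1 _) (gadget_connect f d.1 _ p).
by apply/existsP; exists d; rewrite df; apply/eqP.
Qed.

Lemma connect_ends (H : graph) (f : edge H) (a b x y : vertex H) :
  [set a; b] = [set x; y] -> connect (adj_avoid f) a b ->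
  connect (adj_avoid f) x y.
Proof.
move=> abxy ab.
have : x \in [set a; b] by rewrite abxy finset.set21.
have : y \in [set a; b] by rewrite abxy finset.set22.
rewrite !inE => /orP[] /eqP -> /orP[] /eqP -> //.
by rewrite connect_avoid_sym.
Qed.

(** A step along an edge [d] other than [f.1] becomes a passage through the copy of [d], which does
    not contain [f]. *)
Lemma lift_connect (f : edge substitute) x y :
  connect (adj_avoid f.1) x y ->
  connect (@adj_avoid substitute f) (inl x) (inl y).
Proof.
move=> /connectP[p pp ->]; elim: p x pp => //= z p IHp x /andP[xz /IHp].
apply: connect_trans; have /existsP[d /andP[df /eqP dxz]] := xz.
apply: (@connect_ends substitute f (inl (src d)) (inl (tgt d))).
  have := congr1 (fun A : {set vertex G} => [set (inl u : sub_vertex) | u in A])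
    (etrans (esym (ends_src_tgt d)) dxz).
  by rewrite !imsetU !imset_set1.
have dne i : (d, i) != f by apply: contra df => /eqP <-.
apply: connect_trans (@sub_edge_connect f (d, ord0) ord0 _) _ => //.
rewrite connect_avoid_sym.
exact: (@sub_edge_connect f (d, ord_max) ord0).
Qed.

(** If [f] is a half-edge, the detour crosses [G] to the other end of the replaced edge and enters
    the copy through the other half-edge. If [f] is a full edge, the detour stays inside the
    copy. *)
Lemma substitute_bridgeless :
  (forall e : edge G, connect (adj_avoid e) (src e) (tgt e)) ->
  forall (f : edge substitute) (x y : vertex substitute),
    ends f = [set x; y] -> connect (adj_avoid f) x y.
Proof.
move=> nobridge f x y fxy.
apply: connect_ends fxy _; case: f => e i {x y}.
have [->|i0] := eqVneq i ord0; last have [->|i15] := eqVneq i ord_max.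
- apply: (@connect_trans (vertex substitute) _ (inl (tgt e))).
    exact: (@lift_connect (e, ord0)).
  by apply: (@sub_edge_connect (e, ord0) (e, ord_max)); rewrite xpair_eqE andbF.
- apply: (@connect_trans (vertex substitute) _ (inl (src e))).
    by rewrite connect_avoid_sym; apply: (@lift_connect (e, ord_max)).
  by apply: (@sub_edge_connect (e, ord_max) (e, ord0)); rewrite xpair_eqE andbF.
- by rewrite /sub_end1 /= !ifN //; apply: gadget_connect.
Qed.

Lemma substitute_cubic_bridgeless :
  cubic_bridgeless G -> cubic_bridgeless substitute.
Proof.
move=> [/card_gt0P[v _] cubG brG]; split.
- by apply/card_gt0P; exists (inl v).
- exact: substitute_cubic.
- apply: connect_avoid_bridgeless; first exact: substitute_cubic.
  apply: substitute_bridgeless => e.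
  exact: bridgeless_connect_avoid (brG _) (ends_src_tgt e).
Qed.

(** * Perfect matchings of the substituted graph and their traces on [G] *)

Definition trace (M : {set edge substitute}) : {set edge G} :=
  [set e | (e, ord0) \in M].

(** The matching conditions at the ten vertices of a copy involve only edges of that copy. *)
Lemma slice_matching (M : {set edge substitute}) e :
  perfect_matching M ->
  exists2 t, t \in gadget_matchings &
    forall i : 'I_16, ((e, i) \in M) = (val i \in t).
Proof.
move=> /forallP pm.
have [p p10|t tP bt] := @gadget_perfect_matching (fun k => (e, inord k) \in M).
  apply: etrans (eqP (pm (inr (e, Ordinal p10)))).
  rewrite -card_ord_count -(card_pair_slice e).
  apply: eq_card => -[d i]; rewrite edges_at_inr !inE /= inord_val.
  by case: eqVneq => [->|_]; rewrite ?andbF //= andbC.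
exists t => // i; have := bt i.
by rewrite mem_iota inord_val; apply; apply: ltn_ord.
Qed.

(** Each of the six matchings contains both half-edges or neither, so reading the trace off
    half-edge 0 loses nothing. *)
Lemma half_edge_mem (M : {set edge substitute}) v e :
  perfect_matching M -> (half_edge v e \in M) = (e \in trace M).
Proof.
move=> pmM; have [t tP Mt] := slice_matching e pmM.
rewrite inE /half_edge; case: ifP => // _; rewrite !Mt /=.
by apply/eqP; move: t tP {Mt}; apply/allP.
Qed.

Lemma trace_perfect_matching (M : {set edge substitute}) :
  perfect_matching M -> perfect_matching (trace M).
Proof.
move=> pmM; apply/forallP => v; have /forallP/(_ (inl v)) := pmM.
rewrite edges_at_inl -(card_imset _ (@half_edge_inj v)).
congr (_ == _); apply: eq_card => d; rewrite inE.
apply/andP/imsetP => [[dM /imsetP[e ev de]]|[e]].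
  by exists e; rewrite // inE ev andbT -(half_edge_mem v) // -de.
rewrite inE => /andP[eM ev] ->; rewrite half_edge_mem //; split=> //.
exact: imset_f.
Qed.

Lemma card_sum_mem (T : finType) (A : {set T}) : #|A| = \sum_x (x \in A).
Proof. by rewrite -sum1_card big_mkcond; apply: eq_bigr => x _; case: ifP. Qed.

(** This is [gadget_cover] summed over all copies. *)
Lemma trace_cover (M1 M2 M3 : {set edge substitute}) :
  perfect_matching M1 -> perfect_matching M2 -> perfect_matching M3 ->
  #|M1 :|: M2 :|: M3| + 3 * #|trace M1 :&: trace M2 :&: trace M3| <=
  12 * #|edge G| + #|trace M1 :|: trace M2 :|: trace M3|.
Proof.
move=> pm1 pm2 pm3; rewrite [X in X + _]card_pair_sum !card_sum_mem.
have -> : 12 * #|edge G| = \sum_(e : edge G) 12 by rewrite sum_nat_const mulnC.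
rewrite big_distrr /= -!big_split /=.
apply: leq_sum => e _.
have [t1 t1P Mt1] := slice_matching e pm1.
have [t2 t2P Mt2] := slice_matching e pm2.
have [t3 t3P Mt3] := slice_matching e pm3.
have := gadget_cover t1P t2P t3P; rewrite -card_ord_count !inE !Mt1 !Mt2 !Mt3.
congr (_ + 3 * nat_of_bool _ <= _ + nat_of_bool _);
  rewrite -?andbA -?orbA //.
by apply: eq_card => i; rewrite !inE Mt1 Mt2 Mt3 orbA.
Qed.

(** A common edge of the traces puts both of its half-edges into all three matchings. *)
Lemma trace_common (M1 M2 M3 : {set edge substitute}) :
  perfect_matching M1 -> perfect_matching M2 -> perfect_matching M3 ->
  2 * #|trace M1 :&: trace M2 :&: trace M3| <= #|M1 :&: M2 :&: M3|.
Proof.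
move=> pm1 pm2 pm3; rewrite [leqRHS]card_pair_sum card_sum_mem.
rewrite big_distrr /=; apply: leq_sum => e _.
case: (boolP (e \in _)) => //; rewrite 2!inE => /andP[/andP[e1 e2] e3].
suff /subset_leq_card : [set ord0; ord_max] \subset
    [set i : 'I_16 | (e, i) \in M1 :&: M2 :&: M3] by rewrite cards2.
have mem_max M : perfect_matching M -> e \in trace M -> (e, ord_max) \in M.
  move=> pmM; rewrite -(half_edge_mem (tgt e)) // /half_edge.
  by rewrite eq_sym (negPf (src_neq_tgt e)).
rewrite finset.subUset !finset.sub1set !inE !mem_max //.
by move: e1 e2 e3; rewrite !inE => -> -> ->.
Qed.

Lemma card_substitute : #|edge substitute| = 16 * #|edge G|.
Proof. by rewrite card_prod card_ord mulnC. Qed.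

End Substitution.

(** * Iterating the substitution, and the passage from the infimum to matchings *)

Section Cover.
Local Open Scope nat_scope.
Local Open Scope set_scope.

Lemma penalized_cover :
  (forall G, cubic_bridgeless G -> exists M1 M2 M3 : {set edge G},
     [/\ perfect_matching M1, perfect_matching M2, perfect_matching M3 &
         4 * #|edge G| <= 5 * #|M1 :|: M2 :|: M3|]) ->
  forall k G, cubic_bridgeless G -> exists M1 M2 M3 : {set edge G},
     [/\ perfect_matching M1, perfect_matching M2, perfect_matching M3 &
         5 * (k * #|M1 :&: M2 :&: M3|) + 4 * #|edge G| <=
         5 * #|M1 :|: M2 :|: M3|].
Proof.
move=> cover; elim=> [|k IHk] G brG; first exact: cover.
have [M1 [M2 [M3 [pm1 pm2 pm3 bound]]]] :=
  IHk _ (substitute_cubic_bridgeless brG).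
exists (trace M1), (trace M2), (trace M3).
split; try exact: trace_perfect_matching.
have common := trace_common pm1 pm2 pm3; have cover' := trace_cover pm1 pm2 pm3.
(* The ratio 4/5 reproduces itself because 4 * 16 - 5 * 12 = 4. The weight [k] becomes 2k + 3, which
   is at least k + 1. *)
rewrite card_substitute in bound; nia.
Qed.

End Cover.

Lemma max_cover_attained (R : realType) (G : graph) :
  4 / 5 <= max_cover G R 3 -> exists M1 M2 M3 : {set edge G},
    [/\ perfect_matching M1, perfect_matching M2, perfect_matching M3 &
        (4 * #|edge G| <= 5 * #|(M1 :|: M2 :|: M3)%SET|)%N].
Proof.
move=> cover; have [/existsP[M /andP[/forallP pmM coverM]]|noM] :=
  boolP [exists M : {ffun 'I_3 -> {set edge G}},
           [forall i, perfect_matching (M i)] &&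
           (4 / 5 <= #|(\bigcup_(i < 3) M i)%SET|%:R / #|edge G|%:R :> R)].
  exists (M 0), (M 1), (M 2); split=> //.
  (* Clearing the denominator requires a nonzero number of edges. *)
  have [->|E0] := eqVneq #|edge G| 0%N; first by rewrite muln0.
  move: coverM; rewrite ler_pdivlMr ?ltr0n ?lt0n // mulrAC ler_pdivrMr //.
  rewrite -!natrM ler_nat mulnC [leqRHS]mulnC !big_ord_recl big_ord0.
  rewrite finset.setU0 finset.setUA.
  by congr (_ <= _ * #|_ :|: M _ :|: M _|)%N; apply: val_inj.
(* The default value 0 of the maximum is also below 4/5, so some triple must reach the bound. *)
suff : max_cover G R 3 < 4 / 5 by rewrite ltNge cover.
apply: bigmax_lt => [|M pmM]; first by rewrite divr_gt0.
by move: noM; rewrite negb_exists => /forallP/(_ M); rewrite pmM /= -ltNge.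
Qed.

Theorem theorem7 (R : realType) (hm3 : inf_max_cover R 3 = 4 / 5) :
  (forall G : graph, cubic_bridgeless G ->
     exists M1 M2 M3 : {set edge G},
       [/\ [/\ perfect_matching M1, perfect_matching M2 & perfect_matching M3],
           (M1 :&: M2 :&: M3)%SET = finset.set0 &
           4 / 5 * #|edge G|%:R <= #|(M1 :|: M2 :|: M3)%SET|%:R :> R]) /\
  (forall G : graph, cubic_bridgeless G ->
     exists M1 M2 M3 : {set edge G},
       [/\ perfect_matching M1, perfect_matching M2, perfect_matching M3 &
           (M1 :&: M2 :&: M3)%SET = finset.set0]).
Proof.
have attained G : cubic_bridgeless G -> 4 / 5 <= max_cover G R 3.
  move=> brG; rewrite -hm3; apply: ge_inf; last by exists G.
  (* The infimum bounds its set from below once the set has a lower bound; 0 is one. *)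
  exists 0 => _ [H [_ ->]]; exact: bigmax_ge_id.
have cover G : cubic_bridgeless G -> exists M1 M2 M3 : {set edge G},
    [/\ [/\ perfect_matching M1, perfect_matching M2 & perfect_matching M3],
        (M1 :&: M2 :&: M3)%SET = finset.set0 &
        4 / 5 * #|edge G|%:R <= #|(M1 :|: M2 :|: M3)%SET|%:R :> R].
  move=> brG.
  have [M1 [M2 [M3 [pm1 pm2 pm3 bound]]]] :=
    penalized_cover (fun H brH => max_cover_attained (attained H brH))
      #|edge G|.+1 brG.
  exists M1, M2, M3; split=> //.
    (* With weight |E| + 1, one common edge would already make the left side exceed 5|E|, while the
       union has at most |E| edges. *)
    apply: cards0_eq; have := max_card (M1 :|: M2 :|: M3)%SET.
    move: bound; case: #|(M1 :&: _ :&: _)%SET| => // c.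
    rewrite [(_ * c.+1)%N]mulnS; lia.
  rewrite mulrAC ler_pdivrMr // -!natrM ler_nat; lia.
split=> // G /cover[M1 [M2 [M3 [[pm1 pm2 pm3] common0 _]]]].
by exists M1, M2, M3.
Qed.
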